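(* There exist a three-dimensional cyclic matching instance $\mathcal I$ (with possibly incomplete preference lists) and a matching $M$ in $\mathcal I$ such that $M$ is strongly stable but not popular.
   Context: A three-dimensional cyclic matching instance with (possibly) incomplete lists consists of three pairwise disjoint finite sets (agent classes) $A,B,C$ with $|A|=|B|=|C|=n$. Each agent in $A$ (resp. $B$, resp. $C$) has a strict preference list over a subset of the agents in $B$ (resp. $C$, resp. $A$); the agents on the list of $x$ are called acceptable to $x$, and $\succ_x$ denotes the strict order, $y\succ_x z$ meaning that $x$ prefers $y$ to $z$. By convention $x$ itself is placed at the end of $\succ_x$ (being unmatched is worst). Let $V=A\cup B\cup C$. A matching $M$ is a subset of $A\times B\times C$ such that each agent appears in at most one triple and for each $(a,b,c)\in M$, $a$ finds $b$ acceptable, $b$ finds $c$ acceptable, and $c$ finds $a$ acceptable. If $(a,b,c)\in M$, write $M(a)=b$, $M(b)=c$, $M(c)=a$; if $x$ is in no triple of $M$, then $M(x)=x$. Agents compare triples containing them by their partner in the triple ($a$ by $b$, $b$ by $c$, $c$ by $a$). A triple $t=(a,b,c)$ (with $a$ finding $b$, $b$ finding $c$, and $c$ finding $a$ acceptable) is a weakly blocking triple for $M$ if at least two of its agents prefer $t$ to their situation in $M$ while the remaining agent does not prefer her situation in $M$ to $t$. $M$ is strongly stable if it admits no weakly blocking triple. For matchings $M',M$ and an agent $x$, let $\mathrm{vote}_x(M',M)=1$ if $M'(x)\succ_x M(x)$, $0$ if $M'(x)=M(x)$, and $-1$ if $M(x)\succ_x M'(x)$. $M'$ is more popular than $M$ if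 $\sum_{x\in V}\mathrm{vote}_x(M',M)\ge 1$. $M$ is popular if no matching is more popular than $M$. *)

(* Defs.v *)
From HB Require Import structures.
From mathcomp Require Import all_boot all_order all_algebra.

Set Implicit Arguments.
Unset Strict Implicit.
Unset Printing Implicit Defensive.

(* A strict preference list over a subset of the next class is a duplicate-free
   sequence, most preferred agent first. *)
Record instance := Instance {
  class_size : nat;
  agentA : finType;
  agentB : finType;
  agentC : finType;
  card_agentA : #|agentA| = class_size;
  card_agentB : #|agentB| = class_size;
  card_agentC : #|agentC| = class_size;
  listA : agentA -> seq agentB;
  listB : agentB -> seq agentC;
  listC : agentC -> seq agentA;
  uniq_listA : forall a, uniq (listA a);
  uniq_listB : forall b, uniq (listB b);
  uniq_listC : forall c, uniq (listC c)
}.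

(* The disjoint union V of the three classes. *)
Definition agent (I : instance) : finType :=
  (agentA I + agentB I + agentC I)%type.

Definition inA (I : instance) (a : agentA I) : agent I := inl (inl a).
Definition inB (I : instance) (b : agentB I) : agent I := inl (inr b).
Definition inC (I : instance) (c : agentC I) : agent I := inr c.

Definition triple (I : instance) : finType :=
  (agentA I * agentB I * agentC I)%type.

Definition trA (I : instance) (t : triple I) : agentA I := t.1.1.
Definition trB (I : instance) (t : triple I) : agentB I := t.1.2.
Definition trC (I : instance) (t : triple I) : agentC I := t.2.

Definition acceptable_agents (I : instance) (x : agent I) : seq (agent I) :=
  match x with
  | inl (inl a) => map (@inB I) (listA a)
  | inl (inr b) => map (@inC I) (listB b)
  | inr c => map (@inA I) (listC c)
  end.

(* The order of x ranks her acceptable agents and then x herself, last. *)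
Definition ranking (I : instance) (x : agent I) : seq (agent I) :=
  rcons (acceptable_agents x) x.

(* x strictly prefers y to z; agents outside [ranking x] are incomparable. *)
Definition prefers (I : instance) (x y z : agent I) : bool :=
  [&& y \in ranking x, z \in ranking x
    & index y (ranking x) < index z (ranking x)].

Definition acceptable_triple (I : instance) (t : triple I) : bool :=
  [&& trB t \in listA (trA t), trC t \in listB (trB t)
    & trA t \in listC (trC t)].

Definition is_matching (I : instance) (M : {set triple I}) : Prop :=
  [/\ {in M &, injective (@trA I)},
      {in M &, injective (@trB I)},
      {in M &, injective (@trC I)}
    & {in M, forall t, acceptable_triple t}].

(* M(x), equal to x when x is in no triple of M. When M is a matching, the
   triple of M containing x, if any, is unique, so [pick] makes no choice. *)
Definition partner (I : instance) (M : {set triple I}) (x : agent I) :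
    agent I :=
  match x with
  | inl (inl a) =>
      if [pick t in M | trA t == a] is Some t then inB (trB t) else x
  | inl (inr b) =>
      if [pick t in M | trB t == b] is Some t then inC (trC t) else x
  | inr c =>
      if [pick t in M | trC t == c] is Some t then inA (trA t) else x
  end.

Definition weakly_blocking (I : instance) (M : {set triple I}) (t : triple I) :
    bool :=
  let a := inA (trA t) in
  let b := inB (trB t) in
  let c := inC (trC t) in
  let a_gains := prefers a b (partner M a) in
  let b_gains := prefers b c (partner M b) in
  let c_gains := prefers c a (partner M c) in
  let a_loses := prefers a (partner M a) b in
  let b_loses := prefers b (partner M b) c in
  let c_loses := prefers c (partner M c) a in
  acceptable_triple t &&
  [|| [&& a_gains, b_gains & ~~ c_loses],
      [&& a_gains, c_gains & ~~ b_loses]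
    | [&& b_gains, c_gains & ~~ a_loses]].

Definition strongly_stable (I : instance) (M : {set triple I}) : Prop :=
  forall t : triple I, ~~ weakly_blocking M t.

(* For matchings, both partners of x occur in [ranking x], so the value 0 is
   taken exactly when they are equal. *)
Definition vote (I : instance) (M' M : {set triple I}) (x : agent I) : int :=
  (if prefers x (partner M' x) (partner M x) then 1
   else if prefers x (partner M x) (partner M' x) then -1
   else 0)%R.

Definition more_popular (I : instance) (M' M : {set triple I}) : Prop :=
  (1 <= \sum_(x : agent I) vote M' M x)%R.

Definition popular (I : instance) (M : {set triple I}) : Prop :=
  forall M' : {set triple I}, is_matching M' -> ~ more_popular M' M.

(* Main.v *)
(* Take n = 2 and M = {(a0,b0,c0)}, M' = {(a0,b1,c1), (a1,b0,c0)}, with only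
   the edges of these three triples acceptable, a0 preferring b0 to b1 and c0
   preferring a0 to a1. Neither triple of M' is weakly blocking, as a0 loses in
   the first and c0 in the second; but a1, b1, c1 prefer M', only a0 and c0
   prefer M, and b0 is indifferent. *)
Require Import Defs.
From HB Require Import structures.
From mathcomp Require Import all_boot all_order all_algebra.

Set Implicit Arguments.
Unset Strict Implicit.
Unset Printing Implicit Defensive.

Section Partner.

Variables (I : instance) (M : {set triple I}).

(** Injectivity of the three projections on [M] forces the triple returned by [pick] to be [t]
    itself. *)
Lemma partner_matched (t : triple I) : is_matching M -> t \in M ->
  [/\ partner M (inA (trA t)) = inB (trB t),
      partner M (inB (trB t)) = inC (trC t)
    & partner M (inC (trC t)) = inA (trA t)].
Proof.
case=> injA injB injC _ tM.
split; rewrite /partner /=; case: pickP => [u /andP[uM /eqP eq_ut]|/(_ t)];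
  rewrite ?tM ?eqxx //.
- by rewrite (injA _ _ uM tM eq_ut).
- by rewrite (injB _ _ uM tM eq_ut).
- by rewrite (injC _ _ uM tM eq_ut).
Qed.

Lemma partner_unmatchedA (a : agentA I) :
  {in M, forall t, trA t != a} -> partner M (inA a) = inA a.
Proof.
by move=> aM; rewrite /partner /=; case: pickP => // t /andP[/aM/negPf->].
Qed.

Lemma partner_unmatchedB (b : agentB I) :
  {in M, forall t, trB t != b} -> partner M (inB b) = inB b.
Proof.
by move=> bM; rewrite /partner /=; case: pickP => // t /andP[/bM/negPf->].
Qed.

Lemma partner_unmatchedC (c : agentC I) :
  {in M, forall t, trC t != c} -> partner M (inC c) = inC c.
Proof.
by move=> cM; rewrite /partner /=; case: pickP => // t /andP[/cM/negPf->].
Qed.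

End Partner.

(* The booleans [false] and [true] stand for the indices 0 and 1. *)
Definition ex_listA (a : bool) := if a then [:: false] else [:: false; true].
Definition ex_listB (b : bool) := [:: b].
Definition ex_listC (c : bool) := if c then [:: false] else [:: false; true].

Lemma uniq_ex_listA a : uniq (ex_listA a). Proof. by case: a. Qed.
Lemma uniq_ex_listB b : uniq (ex_listB b). Proof. by []. Qed.
Lemma uniq_ex_listC c : uniq (ex_listC c). Proof. by case: c. Qed.

Definition ex_inst : instance :=
  Instance card_bool card_bool card_bool
    uniq_ex_listA uniq_ex_listB uniq_ex_listC.

Definition ex_triple (a b c : bool) : triple ex_inst := (a, b, c).

Definition ex_M : {set triple ex_inst} := [set ex_triple false false false].

Definition ex_M' : {set triple ex_inst} :=
  [set ex_triple false true true; ex_triple true false false].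

Lemma ex_M_matching : is_matching ex_M.
Proof.
by split=> [t u|t u|t u|t]; rewrite !inE => /eqP-> // /eqP->.
Qed.

Lemma ex_M'_matching : is_matching ex_M'.
Proof.
by split=> [t u|t u|t u|t]; rewrite !inE => /orP[] /eqP-> // /orP[] /eqP->.
Qed.

(** A form of [partner ex_M] free of [pick], so that blocking and votes can be settled by
    computation. *)
Definition ex_partner (x : agent ex_inst) : agent ex_inst :=
  match x with
  | inl (inl a) => if a then x else @inB ex_inst false
  | inl (inr b) => if b then x else @inC ex_inst false
  | inr c => if c then x else @inA ex_inst false
  end.

Definition ex_partner' (x : agent ex_inst) : agent ex_inst :=
  match x with
  | inl (inl a) => @inB ex_inst (~~ a)
  | inl (inr b) => @inC ex_inst b
  | inr c => @inA ex_inst (~~ c)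
  end.

Lemma partner_ex_M : partner ex_M =1 ex_partner.
Proof.
have [pA pB pC] := partner_matched ex_M_matching (set11 _).
(* The triple in [ex_M] settles the agents of index 0; those of index 1 remain, all unmatched. *)
case=> [[]|] [] //.
- by apply: partner_unmatchedA => t /set1P->.
- by apply: partner_unmatchedB => t /set1P->.
- by apply: partner_unmatchedC => t /set1P->.
Qed.

(** The two triples cover all six agents, so their six partner equations exhaust the cases. *)
Lemma partner_ex_M' : partner ex_M' =1 ex_partner'.
Proof.
have [pA0 pB1 pC1] := partner_matched ex_M'_matching (set21 _ _).
have [pA1 pB0 pC0] := partner_matched ex_M'_matching (set22 _ _).
by case=> [[]|] [].
Qed.

Lemma ex_M_strongly_stable : strongly_stable ex_M.
Proof.
(* Of the eight triples, five are unacceptable, and in the triple of [ex_M] nobody gains. *)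
by move=> [[a b] c]; rewrite /weakly_blocking !partner_ex_M; case: a b c => [] [] [].
Qed.

Lemma ex_M'_more_popular : more_popular ex_M' ex_M.
Proof.
rewrite /more_popular.
under eq_bigr do rewrite /vote partner_ex_M partner_ex_M'.
(* The votes cancel within the first class and within the third; in the second, one agent keeps her
   partner and the other becomes matched, so the sum is exactly 1. *)
by rewrite !big_sumType /= !big_bool.
Qed.

Theorem lemma1 :
  exists (I : instance) (M : {set triple I}),
    is_matching M /\ strongly_stable M /\ ~ popular M.
Proof.
exists ex_inst, ex_M; split; first exact: ex_M_matching.
split; first exact: ex_M_strongly_stable.
by move/(_ _ ex_M'_matching); apply; exact: ex_M'_more_popular.
Qed.
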